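(* Let $B$ be a finite cyclic left brace (i.e. a finite left brace whose additive group is cyclic) and let $(X,r)$ be an indecomposable solution whose permutation left brace $\mathcal{G}(X,r)$ is isomorphic to $B$ as a left brace. Then $\mathrm{Ret}^n(X,r)$ is a uniconnected solution for all $n\in\mathbb{N}\cup\{0\}$.
   Context: A solution is a pair $(X,r)$ with $X$ a non-empty set and $r:X\times X\to X\times X$, $r(x,y)=(\sigma_x(y),\tau_y(x))$, such that $(r\times \mathrm{id})(\mathrm{id}\times r)(r\times \mathrm{id})=(\mathrm{id}\times r)(r\times \mathrm{id})(\mathrm{id}\times r)$ on $X^3$, $r^2=\mathrm{id}$ (involutive), and all maps $\sigma_x,\tau_y:X\to X$ are bijections (non-degenerate). The permutation group $\mathcal{G}(X,r)$ is the subgroup of $\mathrm{Sym}(X)$ generated by all $\sigma_x$. $(X,r)$ is indecomposable if $\mathcal{G}(X,r)$ acts transitively on $X$, and uniconnected if $\mathcal{G}(X,r)$ acts regularly on $X$. A left brace is a set $B$ with two operations $+,\circ$ such that $(B,+)$ is an abelian group, $(B,\circ)$ is a group and $a\circ(b+c)=a\circ b-a+a\circ c$ for all $a,b,c$. For $a\in B$ put $\lambda_a(b)=-a+a\circ b$. The permutation left brace of $(X,r)$ is $\mathcal{G}(X,r)$ with $\circ$ equal to composition and with the unique addition making it a left brace such that $\lambda_g(\sigma_x)=\sigma_{g(x)}$ for all $g\in\mathcal{G}(X,r)$, $x\in X$. Retraction: define $x\sim_r y$ iff $\sigma_x=\sigma_y$. The solution $r$ induces canonically a solution on the quotient set $X/\!\sim_r$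 (by $([x],[y])\mapsto([\sigma_x(y)],[\tau_y(x)])$), denoted $\mathrm{Ret}(X,r)$. Set $\mathrm{Ret}^0(X,r)=(X,r)$ and $\mathrm{Ret}^{n+1}(X,r)=\mathrm{Ret}(\mathrm{Ret}^{n}(X,r))$. *)

(* Defs.v *)
From HB Require Import structures.
From mathcomp Require Import all_boot all_algebra.
From mathcomp Require Import boolp.

Set Implicit Arguments.
Unset Strict Implicit.
Unset Printing Implicit Defensive.

Import GRing.Theory.
Local Open Scope ring_scope.
Local Open Scope quotient_scope.

Record sym (X : choiceType) :=
  Sym { sym_fun :> X -> X; sym_bij : bijective sym_fun }.
HB.instance Definition _ X := gen_eqMixin (sym X).
HB.instance Definition _ X := gen_choiceMixin (sym X).

Lemma symP (X : choiceType) (s t : sym X) : s =1 t -> s = t.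
Proof.
case: s t => [f bf] [g bg] /= /funext fg; case: _ / fg in bg *.
by congr Sym; exact: Prop_irrelevance.
Qed.

Lemma inj_surj_bij (X Y : Type) (f : X -> Y) :
  injective f -> (forall y, exists x, f x = y) -> bijective f.
Proof.
by move=> fI /choice[g gK]; exists g => // x; apply: fI; rewrite gK.
Qed.

Section SymGroup.
Variable X : choiceType.

Lemma sym_inv_ex (s : sym X) : exists t : sym X, cancel s t /\ cancel t s.
Proof.
case: (sym_bij s) => t sK tK.
have bt : bijective t by exists s.
by exists (Sym bt).
Qed.

Definition sym_one : sym X := Sym (@inv_bij X id (fun=> erefl)).
Definition sym_mul (s t : sym X) : sym X := Sym (bij_comp (sym_bij s) (sym_bij t)).
Definition sym_inv (s : sym X) : sym X := sval (cid (sym_inv_ex s)).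

Fact sym_mulA : associative sym_mul. Proof. by move=> s t u; apply: symP. Qed.
Fact sym_mul1 : left_id sym_one sym_mul. Proof. by move=> s; apply: symP. Qed.
Fact sym_1mul : right_id sym_one sym_mul. Proof. by move=> s; apply: symP. Qed.
Fact sym_mulV : left_inverse sym_one sym_inv sym_mul.
Proof.
by move=> s; apply: symP => x; rewrite /sym_inv; case: cid => t [/= sK _]; exact: sK.
Qed.
Fact sym_Vmul : right_inverse sym_one sym_inv sym_mul.
Proof.
by move=> s; apply: symP => x; rewrite /sym_inv; case: cid => t [/= _ tK]; exact: tK.
Qed.

(* The product is composition of functions, (s * t) x = s (t x), which is the *)
(* opposite of the convention for {perm T}.                                   *)
HB.instance Definition _ :=
  isGroup.Build (sym X) sym_mulA sym_mul1 sym_1mul sym_mulV sym_Vmul.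

Lemma symM (s t : sym X) x : (s * t : sym X)%g x = s (t x). Proof. by []. Qed.
Lemma sym1 x : (1%g : sym X) x = x. Proof. by []. Qed.
Lemma symK (s : sym X) : cancel s (s^-1 : sym X)%g.
Proof. by move=> x; rewrite -symM mulVg. Qed.
Lemma symVK (s : sym X) : cancel (s^-1 : sym X)%g s.
Proof. by move=> x; rewrite -symM mulgV. Qed.

End SymGroup.

Inductive generated (G : groupType) (S : G -> Prop) : G -> Prop :=
| gen_mem g : S g -> generated S g
| gen_one : generated S 1%g
| gen_mul g h : generated S g -> generated S h -> generated S (g * h)%g
| gen_inv g : generated S g -> generated S (g^-1)%g.

Definition r12 (X : Type) (r : X * X -> X * X) (p : X * X * X) : X * X * X :=
  (r p.1, p.2).
Definition r23 (X : Type) (r : X * X -> X * X) (p : X * X * X) : X * X * X :=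
  let q := r (p.1.2, p.2) in (p.1.1, q.1, q.2).

(* r (x, y) = (sigma x y, tau y x): tau_y is indexed by the second component. *)
HB.mixin Record isSolution X of Choice X := {
  sol_map : X * X -> X * X;
  sol_nonempty : inhabited X;
  sol_braid : r12 sol_map \o r23 sol_map \o r12 sol_map
              =1 r23 sol_map \o r12 sol_map \o r23 sol_map;
  sol_invol : involutive sol_map;
  sol_bijl : forall x, bijective (fun y => (sol_map (x, y)).1);
  sol_bijr : forall y, bijective (fun x => (sol_map (x, y)).2)
}.

#[short(type="solutionType")]
HB.structure Definition Solution := {X of isSolution X & Choice X}.

Definition sigma (X : solutionType) (x : X) : sym X := Sym (sol_bijl x).
Definition tau (X : solutionType) (y : X) : sym X := Sym (sol_bijr y).

Section SolutionTheory.
Variable X : solutionType.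
Implicit Types x y z : X.

Lemma sol_mapE x y : sol_map (x, y) = (sigma x y, tau y x).
Proof. by rewrite [LHS]surjective_pairing. Qed.

Lemma sigma_invol x y : sigma (sigma x y) (tau y x) = x.
Proof. by have := sol_invol (x, y); rewrite !sol_mapE => -[]. Qed.

Lemma tau_invol x y : tau (tau y x) (sigma x y) = y.
Proof. by have := sol_invol (x, y); rewrite !sol_mapE => -[]. Qed.

Lemma sigma_braid x y : (sigma (sigma x y) * sigma (tau y x) = sigma x * sigma y)%g.
Proof.
apply: symP => z; have := sol_braid (x, y, z).
by rewrite /r12 /r23 /= !(sol_mapE, symM) /= => -[].
Qed.

Lemma tau_braid y z : (tau (tau z y) * tau (sigma y z) = tau z * tau y)%g.
Proof.
apply: symP => x; have := sol_braid (x, y, z).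
by rewrite /r12 /r23 /= !(sol_mapE, symM) /= => -[].
Qed.

Definition diag x := ((sigma x)^-1 : sym X)%g x.

Lemma diagE x z : diag x = z <-> sigma x z = x.
Proof.
by split=> [<-|]; rewrite /diag ?symVK// => {2}<-; rewrite symK.
Qed.

Lemma diagE_tau x z : diag x = z <-> tau z x = z.
Proof.
rewrite diagE; split=> h.
  by apply: (can_inj (symK (sigma x))); rewrite -{1}h sigma_invol h.
by have := tau_invol x z; rewrite h => h'; apply: (can_inj (symK (tau z))); rewrite h'.
Qed.

Lemma diag_bij : bijective diag.
Proof.
apply: inj_surj_bij => [x y xy|z].
  have /diagE_tau tx := xy; have /diagE_tau ty := erefl (diag y).
  by apply: (can_inj (symK (tau (diag y)))); rewrite tx ty.
by exists (((tau z)^-1 : sym X)%g z); apply/diagE_tau; rewrite symVK.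
Qed.

Lemma diag_tau x y : diag (tau x y) = ((sigma x)^-1 : sym X)%g (diag y).
Proof.
have -> : ((sigma x)^-1 : sym X)%g (diag y) = ((sigma y * sigma x)^-1 : sym X)%g y.
  by rewrite invgM.
rewrite -sigma_braid invgM /diag symM; congr (_ _).
by rewrite -[X in _ = _ X](sigma_invol y x) symK.
Qed.

Lemma sigma_eq_tau x x' : sigma x = sigma x' <-> tau x = tau x'.
Proof.
split=> e.
  by apply: symP => y; apply: (bij_inj diag_bij); rewrite !diag_tau e.
apply: invg_inj; apply: symP => z; case: diag_bij => h _ hK.
by rewrite -(hK z) -!diag_tau e.
Qed.

End SolutionTheory.

Section Retraction.
Variable X : solutionType.
Implicit Types x y : X.

Definition retract_rel : rel X := fun x y => `[< sigma x = sigma y >].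

Lemma retract_equiv : equiv_class_of retract_rel.
Proof.
split=> [x|x y|y x z]; first exact/asboolP.
  by apply/asboolP/asboolP.
by move=> /asboolP xy /asboolP yz; apply/asboolP; rewrite xy.
Qed.

Canonical retract_eqrel := EquivRelPack retract_equiv.

Definition retract := {eq_quot retract_eqrel}.
HB.instance Definition _ := Choice.on retract.
HB.instance Definition _ := EqQuotient.on retract.

Definition retract_class (x : X) : retract := \pi x.
Definition retract_repr (u : retract) : X := repr u.

Lemma retract_ind (P : retract -> Prop) :
  (forall x, P (retract_class x)) -> forall u, P u.
Proof. by move=> Pc u; rewrite -[u]reprK; exact: Pc. Qed.

Lemma retract_classP x y :
  retract_class x = retract_class y <-> sigma x = sigma y.
Proof. by split=> [/eqquotP/asboolP//|e]; apply/eqquotP/asboolP. Qed.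

Lemma retract_reprE x : sigma (retract_repr (retract_class x)) = sigma x.
Proof. by apply/retract_classP; rewrite /retract_class reprK. Qed.

(* Independent of the representatives by retract_mapE below.                  *)
Definition retract_map (p : retract * retract) : retract * retract :=
  let x := retract_repr p.1 in let y := retract_repr p.2 in
  (retract_class (sigma x y), retract_class (tau y x)).

Lemma sigma_sigma_compat x x' y y' : sigma x = sigma x' -> sigma y = sigma y' ->
  sigma (sigma x y) = sigma (sigma x' y').
Proof.
move=> -> ey; have /sigma_eq_tau ty := ey.
apply: (mulIg (sigma (tau y x'))).
by rewrite sigma_braid ey ty sigma_braid.
Qed.

Lemma sigma_tau_compat x x' y y' : sigma x = sigma x' -> sigma y = sigma y' ->
  sigma (tau y x) = sigma (tau y' x').
Proof.
move=> ex /sigma_eq_tau->; have /sigma_eq_tau tx := ex; apply/sigma_eq_tau.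
apply: (mulIg (tau (sigma x y'))).
by rewrite tau_braid ex tx tau_braid.
Qed.

Lemma retract_mapE x y :
  retract_map (retract_class x, retract_class y) =
  (retract_class (sigma x y), retract_class (tau y x)).
Proof.
by congr (_, _); apply/retract_classP; [apply: sigma_sigma_compat|
  apply: sigma_tau_compat]; rewrite /= retract_reprE.
Qed.

Fact retract_nonempty : inhabited retract.
Proof. by case: (sol_nonempty (s := X)) => x; split; exact: retract_class. Qed.

Fact retract_braid :
  r12 retract_map \o r23 retract_map \o r12 retract_map
  =1 r23 retract_map \o r12 retract_map \o r23 retract_map.
Proof.
pose c3 (p : X * X * X) :=
  (retract_class p.1.1, retract_class p.1.2, retract_class p.2).
have h12 p : r12 retract_map (c3 p) = c3 (r12 sol_map p).
  by case: p => [[x y] z]; rewrite /r12 /c3 [X in (X, _)]retract_mapE.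
have h23 p : r23 retract_map (c3 p) = c3 (r23 sol_map p).
  by case: p => [[x y] z]; rewrite /r23 /c3 [retract_map _]retract_mapE.
case=> [[u v] w]; elim/retract_ind: u => x; elim/retract_ind: v => y.
elim/retract_ind: w => z.
have : c3 ((r12 sol_map \o r23 sol_map \o r12 sol_map) (x, y, z)) =
       c3 ((r23 sol_map \o r12 sol_map \o r23 sol_map) (x, y, z)).
  by rewrite sol_braid.
by rewrite /comp -!(h12, h23).
Qed.

Fact retract_invol : involutive retract_map.
Proof.
case; do 2!elim/retract_ind => ?.
by rewrite !retract_mapE sigma_invol tau_invol.
Qed.

Fact retract_bijl u : bijective (fun v => (retract_map (u, v)).1).
Proof.
elim/retract_ind: u => x; apply: inj_surj_bij => [|].
  elim/retract_ind=> y; elim/retract_ind=> y'; rewrite !retract_mapE /= => /retract_classP e.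
  apply/retract_classP; apply: (mulgI (sigma x)); rewrite -(sigma_braid x y) -(sigma_braid x y') e.
  congr (_ * sigma _)%g; apply: (can_inj (symK (sigma (sigma x y')))).
  by rewrite -{1}e !sigma_invol.
elim/retract_ind=> z; exists (retract_class (((sigma x)^-1 : sym X)%g z)).
by rewrite retract_mapE; exact: (congr1 retract_class (symVK (sigma x) z)).
Qed.

Fact retract_bijr v : bijective (fun u => (retract_map (u, v)).2).
Proof.
elim/retract_ind: v => y; apply: inj_surj_bij => [|].
  elim/retract_ind=> x; elim/retract_ind=> x'; rewrite !retract_mapE /= => /retract_classP.
  move=> /sigma_eq_tau e; apply/retract_classP/sigma_eq_tau.
  apply: (mulgI (tau y)); rewrite -(tau_braid x y) -(tau_braid x' y) e.
  congr (_ * tau _)%g; apply: (can_inj (symK (tau (tau y x')))).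
  by rewrite -{1}e !tau_invol.
elim/retract_ind=> z; exists (retract_class (((tau y)^-1 : sym X)%g z)).
by rewrite retract_mapE; exact: (congr1 retract_class (symVK (tau y) z)).
Qed.

HB.instance Definition _ := isSolution.Build retract
  retract_nonempty retract_braid retract_invol retract_bijl retract_bijr.

End Retraction.

Definition Ret (X : solutionType) : solutionType := retract X.

Section PermGroup.
Variable X : solutionType.

Definition perm_pred : pred (sym X) :=
  fun s => `[< generated (fun t => exists x, t = sigma x) s >].

Definition permGroup := {s : sym X | perm_pred s}.
HB.instance Definition _ := SubChoice.on permGroup.

Fact perm_pred_closed : group_closed perm_pred.
Proof.
split; first exact/asboolP/gen_one.
move=> s t /asboolP gs /asboolP gt.
by apply/asboolP/gen_mul => //; exact: gen_inv.
Qed.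

HB.instance Definition _ :=
  SubChoice_isSubGroup.Build (sym X) perm_pred permGroup perm_pred_closed.

Lemma sigma_perm x : perm_pred (sigma x).
Proof. by apply/asboolP/gen_mem; exists x. Qed.

Definition psigma (x : X) : permGroup := Sub (sigma x) (sigma_perm x).

Definition indecomposable : Prop :=
  forall x y : X, exists g : permGroup, val g x = y.

Definition uniconnected : Prop :=
  forall x y : X, exists! g : permGroup, val g x = y.

End PermGroup.

(* (B, +) is the zmodType structure; (B, o) is the groupType one, written     *)
(* multiplicatively in group_scope.                                           *)
HB.mixin Record isLeftBrace B of GRing.Zmodule B & Group B := {
  brace_distr : forall a b c : B,
    (a * (b + c)%R)%g = (a * b)%g - a + (a * c)%g
}.

#[short(type="leftBraceType")]
HB.structure Definition LeftBrace :=
  {B of isLeftBrace B & GRing.Zmodule B & Group B}.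

#[short(type="finLeftBraceType")]
HB.structure Definition FinLeftBrace := {B of LeftBrace B & Finite B}.

Definition lambda (B : leftBraceType) (a b : B) : B := - a + (a * b)%g.

Definition cyclic_brace (B : leftBraceType) : Prop :=
  exists g : B, forall b : B, exists k : int, b = g *~ k.

Definition brace_isomorphic (B C : leftBraceType) : Prop :=
  exists f : B -> C, [/\ bijective f,
    {morph f : a b / a + b} & {morph f : a b / (a * b)%g}].

(* padd_lambda is lambda_g (sigma_x) = sigma_(g x). Such an addition exists   *)
(* and is unique: perm_addition_exists, perm_addition_unique.                 *)
Record perm_addition (X : solutionType) := PermAddition {
  padd : permGroup X -> permGroup X -> permGroup X;
  pzero : permGroup X;
  popp : permGroup X -> permGroup X;
  paddA : associative padd;
  paddC : commutative padd;
  padd0 : left_id pzero padd;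
  paddN : left_inverse pzero popp padd;
  padd_distr : forall a b c : permGroup X,
    (a * padd b c)%g = padd (padd (a * b)%g (popp a)) (a * c)%g;
  padd_lambda : forall (g : permGroup X) (x : X),
    padd (popp g) (g * psigma x)%g = psigma (val g x)
}.

Section PermAdditionExists.
Variable X : solutionType.
Local Notation G := (permGroup X).
Implicit Types (g h a b c : G) (x y : X).

Lemma permGroupP g h : val g =1 val h -> g = h.
Proof. by move=> gh; apply/val_inj/symP. Qed.

Lemma permM g h x : val (g * h)%g x = val g (val h x).
Proof. by []. Qed.

Lemma perm1 x : val (1%g : G) x = x.
Proof. by []. Qed.

Lemma permVK g : cancel (val (g^-1)%g) (val g).
Proof. by move=> x; rewrite -permM mulgV. Qed.

Lemma permK g : cancel (val g) (val (g^-1)%g).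
Proof. by move=> x; rewrite -permM mulVg. Qed.

Lemma permGroup_ind (P : G -> Prop) : P 1%g ->
  (forall g x, P g <-> P (g * psigma x)%g) -> forall g, P g.
Proof.
move=> P1 PM g.
suff H s (gs : generated (fun t => exists x, t = sigma x) s) :
    forall h h', val h' = (val h * s)%g -> P h <-> P h'.
  case: g => s ps; apply/(H s _ 1%g) => //=; first exact/asboolP.
  by rewrite mul1g.
elim: gs => {s} [_ [x ->]||s t gs IHs gt IHt|s gs IHs] h h' e.
- by rewrite (_ : h' = (h * psigma x)%g) //; exact: val_inj.
- by rewrite (_ : h' = h) //; apply: val_inj; rewrite e mulg1.
- have ps : perm_pred s by exact/asboolP.
  rewrite (IHs h (h * Sub s ps)%g) //; apply: IHt.
  by rewrite e mulgA.
- by symmetry; apply: IHs; rewrite e -mulgA mulVg mulg1.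
Qed.

Lemma cycle_set u v :
  (psigma u * psigma (((sigma u)^-1 : sym X)%g v) =
   psigma v * psigma (((sigma v)^-1 : sym X)%g u))%g.
Proof.
set w := ((sigma u)^-1 : sym X)%g v.
have vE : v = sigma u w by rewrite symVK.
apply: val_inj; rewrite [LHS](_ : _ = (sigma u * sigma w)%g) //.
rewrite [RHS](_ : _ = (sigma v * sigma (((sigma v)^-1 : sym X)%g u))%g) //.
rewrite -sigma_braid -vE; congr (_ * sigma _)%g.
by rewrite -[in RHS](sigma_invol u w) -vE symK.
Qed.

(* g |-> sigma x + g for the addition to be built: g + sigma x must be        *)
(* g o sigma (g^-1 x). These maps commute and generate a group acting         *)
(* transitively, hence regularly, on G, whose law is transported to G.        *)
Definition tmap x g : G := (g * psigma (val g^-1%g x))%g.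

Lemma tmap_comm x y g : tmap x (tmap y g) = tmap y (tmap x g).
Proof.
rewrite /tmap -!mulgA !invgM; congr (_ * _)%g.
exact: cycle_set.
Qed.

Lemma tmap_diag x g : val (tmap x g)^-1%g x = diag (val g^-1%g x).
Proof. by rewrite /tmap invgM. Qed.

Lemma tmap_bij x : bijective (tmap x).
Proof.
apply: inj_surj_bij => [g h e|k].
  have := tmap_diag x g; rewrite e tmap_diag => /(bij_inj (@diag_bij X)) gh.
  by move: e; rewrite /tmap gh => /mulIg.
case: (@diag_bij X) => d dK Kd.
pose w := d (val k^-1%g x); exists (k * (psigma w)^-1)%g.
have wE : val ((k * (psigma w)^-1)^-1)%g x = w.
  rewrite invgM invgK permM; have <- : diag w = val k^-1%g x by exact: Kd.
  exact: (symVK (sigma w)).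
by rewrite /tmap wE -mulgA mulVg mulg1.
Qed.

Definition transl x : sym G := Sym (tmap_bij x).

Definition is_transl : sym G -> Prop := generated (fun t => exists x, t = transl x).

Lemma is_transl_comm s t : is_transl s -> is_transl t -> (s * t = t * s)%g.
Proof.
suff {s t} comm1 t x : is_transl t -> commute (transl x) t.
  move=> gs gt; elim: gs => {s} [_ [x ->]||s s' _ IHs _ IHs'|s _ IHs].
  - exact: comm1.
  - by rewrite mul1g mulg1.
  - by rewrite -mulgA IHs' !mulgA IHs.
  - by apply/commute_sym/commuteV/commute_sym.
elim=> {t} [_ [y ->]||s s' _ IHs _ IHs'|s _ IHs].
- by apply: symP => g; exact: tmap_comm.
- exact: commute1.
- exact: commuteM.
- exact: commuteV.
Qed.

Lemma is_transl_trans a : exists t, is_transl t /\ t 1%g = a.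
Proof.
have E g x : (g * psigma x)%g = transl (val g x) g.
  by congr (_ * psigma _)%g; rewrite permK.
have T x : is_transl (transl x) by apply: gen_mem; exists x.
move: a; apply: permGroup_ind => [|g x].
  by exists 1%g; split; first exact: gen_one.
rewrite E; split=> -[t [gt t1]].
  exists (transl (val g x) * t)%g; split; last by rewrite symM t1.
  exact: gen_mul (T _) gt.
exists ((transl (val g x))^-1 * t)%g; split; last by rewrite symM t1 symK.
exact: gen_mul (gen_inv (T _)) gt.
Qed.

Lemma is_transl_inj s t : is_transl s -> is_transl t -> s 1%g = t 1%g -> s = t.
Proof.
move=> gs gt st; apply: symP => a; case: (is_transl_trans a) => u [gu <-].
rewrite -!symM (is_transl_comm gs gu) (is_transl_comm gt gu).
by rewrite !symM st.
Qed.

Lemma is_transl_lmul a t : is_transl t ->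
  exists s, is_transl s /\ forall g, (a * t g)%g = s (a * g)%g.
Proof.
elim=> {t} [_ [x ->]||t u _ [t' [gt tE]] _ [u' [gu uE]]|t _ [t' [gt tE]]].
- exists (transl (val a x)); split; first by apply: gen_mem; exists (val a x).
  move=> g; rewrite /= /tmap mulgA; congr (_ * psigma _)%g.
  by rewrite invgM permM permK.
- by exists 1%g; split; first exact: gen_one.
- by exists (t' * u')%g; split=> [|g]; [exact: gen_mul|rewrite !symM tE uE].
- exists (t'^-1)%g; split=> [|g]; first exact: gen_inv.
  by apply: (can_inj (symK t')); rewrite symVK -tE symVK.
Qed.

Definition tr a : sym G := sval (cid (is_transl_trans a)).

Lemma is_transl_tr a : is_transl (tr a).
Proof. by rewrite /tr; case: cid => t []. Qed.

Lemma tr1 a : tr a 1%g = a.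
Proof. by rewrite /tr; case: cid => t []. Qed.

Lemma trE t a : is_transl t -> t 1%g = a -> tr a = t.
Proof. by move=> gt ta; apply: is_transl_inj; rewrite ?tr1//; exact: is_transl_tr. Qed.

Lemma trD a b : tr (tr a b) = (tr a * tr b)%g.
Proof. by apply: trE; [exact: gen_mul (is_transl_tr _) (is_transl_tr _)|rewrite symM tr1]. Qed.

Lemma trN a : tr ((tr a)^-1%g 1%g) = ((tr a)^-1)%g.
Proof. by apply: trE => //; exact: gen_inv (is_transl_tr _). Qed.

Lemma tr_one : tr 1%g = 1%g.
Proof. by apply: trE => //; exact: gen_one. Qed.

Lemma perm_addition_exists : inhabited (perm_addition X).
Proof.
constructor.
apply: (@PermAddition X (fun a b => tr a b) 1%g (fun a => (tr a)^-1%g 1%g)).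
- by move=> a b c; rewrite trD.
- move=> a b; rewrite -{1}(tr1 b) -{2}(tr1 a) -!symM.
  by rewrite (is_transl_comm (is_transl_tr a) (is_transl_tr b)).
- by move=> a; rewrite tr_one.
- by move=> a; rewrite trN -{2}(tr1 a) symK.
- move=> a b c; have [s [gs sE]] := is_transl_lmul a (is_transl_tr b).
  have -> : (a * b)%g = s a by rewrite -{1}(tr1 b) sE mulg1.
  have trs : tr (s a) = (s * tr a)%g.
    by apply: trE; [exact: gen_mul gs (is_transl_tr _)|rewrite symM tr1].
  by rewrite sE trD trN trs !symM symVK.
- move=> g x; rewrite trN.
  have -> : (g * psigma x)%g = transl (val g x) g.
    by congr (_ * psigma _)%g; rewrite permK.
  have gt : is_transl (transl (val g x)) by apply: gen_mem; exists (val g x).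
  have -> : psigma (val g x) = transl (val g x) 1%g.
    by rewrite /= /tmap mul1g invg1.
  apply: (can_inj (symK (tr g))); rewrite symVK -symM.
  by rewrite -(is_transl_comm gt (is_transl_tr g)) symM tr1.
Qed.

Lemma perm_addition_unique (A A' : perm_addition X) : padd A =2 padd A'.
Proof.
have BNK (B : perm_addition X) a b : padd B a (padd B (popp B a) b) = b.
  by rewrite paddA [padd B a _]paddC paddN padd0.
have padd_psigma (B : perm_addition X) g x : padd B g (psigma x) = tmap x g.
  rewrite -(BNK B g (tmap x g)) /tmap padd_lambda; congr (padd _ _ (psigma _)).
  by rewrite permVK.
have p0 (B : perm_addition X) : pzero B = 1%g.
  have := padd_distr B 1%g (pzero B) (pzero B).
  rewrite padd0 !mul1g padd0 paddC padd0 => o1.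
  by rewrite -[RHS](padd0 B) [X in padd B X]o1 paddN.
have step (B : perm_addition X) a g x :
    padd B a (g * psigma x)%g = tmap (val g x) (padd B a g).
  rewrite -(padd_psigma B) -paddA padd_psigma; congr (padd _ _ (_ * psigma _)%g).
  by rewrite permK.
move=> a; apply: permGroup_ind => [|g x].
  by rewrite -{1}(p0 A) -(p0 A') !(paddC _ a) !padd0.
rewrite !step; split=> [->//|]; exact: (bij_inj (tmap_bij _)).
Qed.

End PermAdditionExists.

Definition the_perm_addition (X : solutionType) : perm_addition X :=
  inhabited_witness (perm_addition_exists X).

Definition permBrace (X : solutionType) : Type := permGroup X.

Section PermBrace.
Variable X : solutionType.
Let A := the_perm_addition X.

HB.instance Definition _ := Group.on (permBrace X).
HB.instance Definition _ := GRing.isZmodule.Build (permBrace X)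
  (paddA A) (paddC A) (padd0 A) (paddN A).
HB.instance Definition _ := isLeftBrace.Build (permBrace X) (padd_distr A).

Lemma lambda_psigma (g : permBrace X) (x : X) :
  lambda g (psigma x : permBrace X) = psigma (val (g : permGroup X) x).
Proof. exact: (padd_lambda A). Qed.

End PermBrace.

(* Main.v *)
Require Import Defs.
From HB Require Import structures.
From mathcomp Require Import all_boot all_algebra.
From mathcomp Require Import boolp.

(** The proof shows that being indecomposable with an additively cyclic
    permutation brace forces a solution to be uniconnected, and that both
    hypotheses pass from [X] to [Ret X]; the result follows by iteration.

    Let [G] be the permutation brace of [X].  Since [(G, +)] is cyclic, every
    [lambda_g], being an additive endomorphism, is multiplication by an integer
    ([cyclic_lambda]), so the maps [lambda_g] commute with each other.  Suppose
    that [h] fixes [x].  Then [lambda_h] fixes [sigma_x], hence by commutation it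
    fixes [lambda_g sigma_x = sigma_(g x)] for all [g], that is all [sigma_y] by
    transitivity; as the [sigma_y] generate [G] additively, [lambda_h] is the
    identity ([stab_lambda]).  Sums and products therefore agree on the
    stabiliser of [x], which is thus an additive subgroup, and
    [g h g^-1 = lambda_g h] is an integer multiple of [h], so it also fixes [x].
    The stabiliser is normal, and a normal stabiliser of a transitive faithful
    action is trivial ([cyclic_uniconnected]).

    For the retraction, an element of [G] acts on the classes of [~], which gives
    a surjective map from [G] to the permutation group of [Ret X]
    ([ret_perm_exists]).  It is additive because [g + sigma_x] is
    [g o sigma_(g^-1 x)] in both braces ([ret_permD]), so that cyclicity is
    inherited ([Ret_cyclic]). *)

Set Implicit Arguments.
Unset Strict Implicit.
Unset Printing Implicit Defensive.

Import GRing.Theory.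
Local Open Scope ring_scope.

Section LeftBrace.
Variable B : leftBraceType.
Implicit Types a b c : B.

Lemma brace_mulE a b : (a * b)%g = a + lambda a b.
Proof. by rewrite /lambda addrA subrr add0r. Qed.

(** Distributivity at [a = 1] reads [b + c = b - 1 + c]. *)
Lemma brace_oneE : 1%g = 0 :> B.
Proof.
have := brace_distr (1%g : B) 0 0.
by rewrite !mul1g !addr0 add0r => /esym/eqP; rewrite oppr_eq0 => /eqP.
Qed.

Lemma lambdaD a b c : lambda a (b + c) = lambda a b + lambda a c.
Proof. by rewrite /lambda brace_distr !addrA. Qed.

Lemma lambda0 a : lambda a 0 = 0.
Proof. by rewrite /lambda -brace_oneE mulg1 brace_oneE addNr. Qed.

Lemma lambda_mulz a b (k : int) : lambda a (b *~ k) = lambda a b *~ k.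
Proof.
have lM (n : nat) : lambda a (b *+ n) = lambda a b *+ n.
  by elim: n => [|n IH]; rewrite ?lambda0// !mulrS lambdaD IH.
case: k => n; first by rewrite -!pmulrn lM.
rewrite NegzE !mulrNz -!pmulrn -lM; apply/eqP.
by rewrite -addr_eq0 -lambdaD addNr lambda0.
Qed.

(** [lambda a] is additive, so it is determined by the multiple of a generator
    to which it sends that generator. *)
Lemma cyclic_lambda : cyclic_brace B ->
  forall a, exists k : int, forall b, lambda a b = b *~ k.
Proof.
move=> [e eG] a; have [k ek] := eG (lambda a e).
exists k => b; have [m ->] := eG b.
by rewrite lambda_mulz ek -!mulrzA mulrC.
Qed.

Lemma cyclic_lambdaC (hB : cyclic_brace B) a b c :
  lambda a (lambda b c) = lambda b (lambda a c).
Proof.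
have [k kE] := cyclic_lambda hB a; have [m mE] := cyclic_lambda hB b.
by rewrite !kE !mE -!mulrzA mulrC.
Qed.

End LeftBrace.

Lemma cyclic_brace_image (B C : leftBraceType) (f : B -> C) :
  {morph f : a b / a + b} -> (forall c, exists b, f b = c) ->
  cyclic_brace B -> cyclic_brace C.
Proof.
move=> fD fS [e eG].
have f_zmod : zmod_morphism f.
  by move=> a b; apply: (addIr (f b)); rewrite -fD !subrK.
pose F : {additive B -> C} := HB.pack f (GRing.isZmodMorphism.Build B C f f_zmod).
exists (f e) => c; have [b <-] := fS c; have [k ->] := eG b.
by exists k; exact: (raddfMz F).
Qed.

Section PermBraceTheory.
Variable X : solutionType.
Local Notation G := (permBrace X).
Implicit Types (g h : G) (x y : X).

(** [act] and [bsigma] retype evaluation and [psigma] at the brace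
    [permBrace X], where both the product and the sum of elements make sense. *)
Definition act g x : X := val (g : permGroup X) x.

Definition bsigma x : G := psigma x.

Lemma actM g h x : act (g * h)%g x = act g (act h x).
Proof. by []. Qed.

Lemma actK g : cancel (act g) (act (g^-1)%g).
Proof. exact: (permK g). Qed.

Lemma actVK g : cancel (act (g^-1)%g) (act g).
Proof. exact: (permVK g). Qed.

Lemma act_inj g h : act g =1 act h -> g = h.
Proof. exact: permGroupP. Qed.

Lemma lambda_bsigma g x : lambda g (bsigma x) = bsigma (act g x).
Proof. exact: lambda_psigma. Qed.

Lemma mul_bsigma g x : (g * bsigma x)%g = g + bsigma (act g x).
Proof. by rewrite brace_mulE lambda_bsigma. Qed.

Lemma add_bsigma g x : g + bsigma x = (g * bsigma (act (g^-1)%g x))%g.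
Proof. by rewrite mul_bsigma actVK. Qed.

(** The additive group is generated by the [sigma_x].  The step is an
    equivalence so that it also covers subtracting a generator. *)
Lemma permBrace_ind (P : G -> Prop) : P 0 ->
  (forall g x, P g <-> P (g + bsigma x)) -> forall g, P g.
Proof.
rewrite -brace_oneE => P1 PD; apply: permGroup_ind => // g x.
by rewrite (mul_bsigma g x).
Qed.

Hypotheses (hX : indecomposable X) (hG : cyclic_brace G).

Lemma act_trans x y : exists g, act g x = y.
Proof. exact: hX. Qed.

(** [lambda_h] fixes [sigma_x], and it commutes with the [lambda_g], which
    carry [sigma_x] to all the other additive generators. *)
Lemma stab_lambda h x : act h x = x -> lambda h =1 id.
Proof.
move=> hx.
have hs y : lambda h (bsigma y) = bsigma y.
  have [g <-] := act_trans x y.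
  by rewrite -lambda_bsigma cyclic_lambdaC// [lambda h _]lambda_bsigma hx.
apply: permBrace_ind => [|g y]; first exact: lambda0.
by rewrite lambdaD hs; split=> [->//|/addIr].
Qed.

(** On the stabiliser of a point [lambda] is trivial, so sums there are
    products. *)
Lemma stab_mulz h x (k : int) : act h x = x -> act (h *~ k) x = x.
Proof.
move=> hx; have hM := stab_lambda hx.
have hn (n : nat) : act (h *+ n) x = x.
  elim: n => [|n IH]; first by rewrite mulr0n -brace_oneE.
  have -> : h *+ n.+1 = (h * (h *+ n))%g by rewrite brace_mulE hM mulrS.
  by rewrite actM IH.
case: k => n; first by rewrite -pmulrn.
rewrite NegzE mulrNz -pmulrn; set p := h *+ n.+1.
have px : act p x = x by exact: hn.
have -> : - p = (p^-1)%g.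
  apply/esym/eqP; rewrite -addr_eq0 addrC -[X in p + X](stab_lambda px).
  by rewrite -brace_mulE mulgV brace_oneE.
by rewrite -[in LHS]px actK.
Qed.

(** [g h g^-1 = lambda_g h] holds because [g h = g + lambda_g h] and
    [(lambda_g h) g = lambda_g h + g]. *)
Lemma stab_normal g h x : act h x = x -> act (g * h * g^-1)%g x = x.
Proof.
move=> hx; have [k kE] := cyclic_lambda hG g.
have kx : act (h *~ k) x = x by exact: stab_mulz.
suff -> : (g * h * g^-1)%g = h *~ k by [].
apply: (mulIg g); rewrite mulgVK.
by rewrite !brace_mulE kE (stab_lambda kx) addrC.
Qed.

Lemma cyclic_uniconnected : uniconnected X.
Proof.
have stab1 h x : act h x = x -> h = 1%g.
  (* Conjugating by [g^-1] shows that [h] also fixes [act g x]. *)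
  move=> hx; apply: act_inj => y; have [g <-] := act_trans x y.
  by have := stab_normal (g^-1)%g hx; rewrite invgK !actM => /(canRL (actVK _)).
move=> x y; have [g gx] := act_trans x y; exists g; split=> // g' g'x.
have /stab1 e : act (g^-1 * g')%g x = x.
  by rewrite actM [act g' x]g'x -gx actK.
by apply: (mulgI (g^-1)%g); rewrite e mulVg.
Qed.

End PermBraceTheory.

Section Retraction.
Variable X : solutionType.
Local Notation G := (permBrace X).
Local Notation G' := (permBrace (Ret X)).
Implicit Types (g h : G) (x y : X).

Definition cls x : Ret X := retract_class x.

Lemma cls_surj (u : Ret X) : exists x, cls x = u.
Proof. by elim/retract_ind: u => x; exists x. Qed.

Lemma act_bsigma_cls x y : act (bsigma (cls x)) (cls y) = cls (act (bsigma x) y).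
Proof. exact: (congr1 fst (retract_mapE x y)). Qed.

(** The induced permutation of the classes is a product of maps
    [sigma_[x]^(+-1)] because the original one is a product of maps
    [sigma_x^(+-1)] and [sigma_x] induces [sigma_[x]]. *)
Lemma ret_perm_exists :
  exists phi : G -> G', forall g x, act (phi g) (cls x) = cls (act g x).
Proof.
suff /choice[phi phiP] : forall g, exists g' : G', forall x,
    act g' (cls x) = cls (act g x) by exists phi.
apply: permGroup_ind => [|g x]; first by exists 1%g.
split=> -[g' g'E].
  by exists (g' * bsigma (cls x))%g => y; rewrite actM act_bsigma_cls g'E.
exists (g' * (bsigma (cls x))^-1)%g => y; rewrite actM.
have [z ->] : exists z, y = act (bsigma x) z.
  by exists (act (bsigma x)^-1%g y); rewrite actVK.
by rewrite -act_bsigma_cls actK g'E actM.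
Qed.

Variable phi : G -> G'.
Hypothesis phiE : forall g x, act (phi g) (cls x) = cls (act g x).

Lemma ret_perm_eq g (g' : G') :
  (forall x, act g' (cls x) = cls (act g x)) -> phi g = g'.
Proof.
by move=> g'E; apply: act_inj => u; have [x <-] := cls_surj u; rewrite phiE g'E.
Qed.

Lemma ret_perm_mul_bsigma g x : phi (g * bsigma x)%g = (phi g * bsigma (cls x))%g.
Proof. by apply: ret_perm_eq => y; rewrite !actM act_bsigma_cls phiE. Qed.

(** [g + sigma_x] is the product of [g] and [sigma_(g^-1 x)], and likewise in
    the quotient, so compatibility with products gives this case of
    additivity; [ret_permD] extends it to all sums. *)
Lemma ret_perm_add_bsigma g x : phi (g + bsigma x) = phi g + bsigma (cls x).
Proof.
by rewrite add_bsigma ret_perm_mul_bsigma mul_bsigma phiE actVK.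
Qed.

Lemma ret_perm0 : phi 0 = 0.
Proof. by rewrite -!brace_oneE; apply: ret_perm_eq. Qed.

Lemma ret_permD : {morph phi : g h / g + h}.
Proof.
move=> g; apply: permBrace_ind => [|h x]; first by rewrite ret_perm0 !addr0.
by rewrite addrA !ret_perm_add_bsigma addrA; split=> [->|/addIr].
Qed.

Lemma ret_perm_surj (g' : G') : exists g, phi g = g'.
Proof.
move: g'; apply: permBrace_ind => [|g' u]; first by exists 0; exact: ret_perm0.
have [x <-] := cls_surj u; split=> -[g gE].
  by exists (g + bsigma x); rewrite ret_perm_add_bsigma gE.
exists (g - bsigma x); apply: (addIr (bsigma (cls x))).
by rewrite -ret_perm_add_bsigma subrK.
Qed.

End Retraction.

Lemma Ret_cyclic (X : solutionType) :
  cyclic_brace (permBrace X) -> cyclic_brace (permBrace (Ret X)).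
Proof.
have [phi phiE] := ret_perm_exists X.
exact: (cyclic_brace_image (ret_permD phiE) (ret_perm_surj phiE)).
Qed.

Lemma Ret_indecomposable (X : solutionType) :
  indecomposable X -> indecomposable (Ret X).
Proof.
have [phi phiE] := ret_perm_exists X.
move=> hX u v; have [x <-] := cls_surj u; have [y <-] := cls_surj v.
by have [g <-] := hX x y; exists (phi g); exact: phiE.
Qed.

Theorem corollary2p3 (B : finLeftBraceType) (hB : cyclic_brace B)
  (X : solutionType) (hX : indecomposable X)
  (hXB : brace_isomorphic (permBrace X) B) (n : nat) :
  uniconnected (iter n Ret X).
Proof.
have hG : cyclic_brace (permBrace X).
  have [f [[f' fK f'K] fD _]] := hXB.
  apply: (@cyclic_brace_image B _ f') hB => [a b|g]; last by exists (f g).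
  by apply: (can_inj fK); rewrite fD !f'K.
suff [iX iG] : indecomposable (iter n Ret X) /\
    cyclic_brace (permBrace (iter n Ret X)) by exact: cyclic_uniconnected.
elim: n => [//|n [iX iG]]; split; first exact: Ret_indecomposable.
exact: Ret_cyclic.
Qed.
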